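(* Let $n\ge2$, $[n]=\{1,\dots,n\}$. For each $i\in[n]$ let $X_i$ be an inf-semilattice and $S_i$ a nonempty comprehensive subset of $X_i$ having an upper bound in $X_i$. For all $i,j\in[n]$ let $u_{i,j}:X_j\to\Lambda$ be a quasi-Leontief function, and suppose that for all $i\in[n]$, $u_i(x_1,\dots,x_n)=\min_{j\in[n]}u_{i,j}(x_j)$. Let $\tilde u_i(x_{-i})=\min_{j\ne i}u_{i,j}(x_j)$. Then a point $x^\star\in\prod_{i\in[n]}S_i$ is a Nash point of the game $(u_i,S_i,X_i)_{i\in[n]}$ if and only if, for all $i\in[n]$, $$x_i^\star\in\arg\max(u_{i,i};S_i)\quad\text{or}\quad u_{i,i}(x_i^\star)\ge\tilde u_i(x^\star_{-i}).$$ Furthermore, if $(x_1^\star,\dots,x_n^\star)$ is a Nash point then so is $(u_{1,1}^\circ(x_1^\star),\dots,u_{n,n}^\circ(x_n^\star))$ and, for all $i\in[n]$, $u_i(x_1^\star,\dots,x_n^\star)\ge u_i(u_{1,1}^\circ(x_1^\star),\dots,u_{n,n}^\circ(x_n^\star))$.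
   Context: $\Lambda$ is a totally ordered set. An inf-semilattice is a partially ordered set in which every two elements have a greatest lower bound. A subset $S$ of a partially ordered set $X$ is comprehensive if $x\in S$, $y\in X$, $y\le x$ imply $y\in S$. A function $u:X\to\Lambda$ on a partially ordered set is quasi-Leontief if for every $x\in X$ the set $\{x'\in X:u(x')\ge u(x)\}$ equals $\{x'\in X:x'\ge a\}$ for some $a\in X$; this $a$ is denoted $u^\circ(x)$. $\arg\max(u;S)$ is the set of maximizers of $u$ over $S$. A Nash point of $(u_i,S_i,X_i)_{i\in[n]}$ is a point $x^\star\in\prod_jS_j$ such that for all $i\in[n]$ and all $x_i\in S_i$, $u_i(x^\star)\ge u_i(x^\star_{-i};x_i)$, where $x^\star_{-i}=(x^\star_j)_{j\neq i}$ and $(x^\star_{-i};x_i)$ is $x^\star$ with the $i$-th coordinate replaced by $x_i$. *)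

(* Defs.v *)
From HB Require Import structures.
From mathcomp Require Import all_boot all_order.
From mathcomp Require Import boolp classical_sets.
Set Implicit Arguments.
Unset Strict Implicit.
Unset Printing Implicit Defensive.
Import Order.TTheory.
Local Open Scope order_scope.
Local Open Scope classical_set_scope.

Definition comprehensive {d} {X : porderType d} (S : set X) : Prop :=
  forall x y : X, S x -> y <= x -> S y.

Definition quasi_leontief {d dL} {X : porderType d} {L : orderType dL}
    (u : X -> L) : Prop :=
  forall x : X, exists a : X,
    [set x' : X | u x <= u x'] = [set x' : X | a <= x'].

(* For quasi-Leontief [u], the set below is a singleton (unique by
   antisymmetry), so the default value [x] of [xget] is not used. *)
Definition ucirc {d dL} {X : porderType d} {L : orderType dL}
    (u : X -> L) (x : X) : X :=
  xget x [set a : X | [set x' : X | u x <= u x'] = [set x' : X | a <= x']].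

Definition argmax {X : Type} {dL} {L : orderType dL} (u : X -> L) (S : set X) :
    set X :=
  [set x : X | S x /\ forall y : X, S y -> u y <= u x].

(* [L] need not have a greatest element, so the iterated minimum is started at
   one of the values of [F]; the result does not depend on which one. *)
Definition finmin {dL} {L : orderType dL} {I : finType} (hI : (0 < #|I|)%N)
    (F : I -> L) : L :=
  \big[Order.min/F (enum_val (Ordinal hI))]_(i : I) F i.

Section Game.
Context {n : nat} {d : 'I_n -> Order.disp_t} {dL : Order.disp_t}.
Context {X : forall i : 'I_n, meetSemilatticeType (d i)} {L : orderType dL}.

Definition profile : Type := forall j : 'I_n, X j.

Definition rival (i : 'I_n) : finType := {j : 'I_n | j != i}.

Definition subprofile (i : 'I_n) : Type := forall j : rival i, X (val j).

Definition drop_player (x : profile) (i : 'I_n) : subprofile i :=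
  fun j => x (val j).

(* [dfwith x xi] is [x] with its [i]-th coordinate replaced by [xi : X i]. *)
Definition nash_point (u : 'I_n -> profile -> L) (S : forall i, set (X i))
    (x : profile) : Prop :=
  (forall j, S j (x j)) /\
  forall (i : 'I_n) (xi : X i), S i xi -> u i (dfwith x xi) <= u i x.

Lemma card_players_gt0 : (1 < n)%N -> (0 < #|'I_n|)%N.
Proof. by rewrite card_ord; exact: ltnW. Qed.

Lemma card_rival_gt0 (hn : (1 < n)%N) (i : 'I_n) : (0 < #|rival i|)%N.
Proof. by rewrite card_sig cardC1 card_ord -subn1 subn_gt0. Qed.

Definition min_utility (hn : (1 < n)%N) (v : forall i j : 'I_n, X j -> L)
    (i : 'I_n) (x : profile) : L :=
  finmin (card_players_gt0 hn) (fun j : 'I_n => v i j (x j)).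

Definition tilde_utility (hn : (1 < n)%N) (v : forall i j : 'I_n, X j -> L)
    (i : 'I_n) (y : subprofile i) : L :=
  finmin (card_rival_gt0 hn i) (fun j : rival i => v i (val j) (y j)).

End Game.

Arguments profile {n d} X.
Arguments subprofile {n d} X i.
Arguments drop_player {n d X} x i _.
Arguments tilde_utility {n d dL X L} hn v i y.

(* Main.v *)
Require Import Defs.
From HB Require Import structures.
From mathcomp Require Import all_boot all_order.
From mathcomp Require Import boolp classical_sets.
Set Implicit Arguments.
Unset Strict Implicit.
Unset Printing Implicit Defensive.
Import Order.TTheory.
Local Open Scope order_scope.
Local Open Scope classical_set_scope.

(** Splitting off player [i] gives [u_i(x) = min(u_ii(x_i), t)], where [t] does
    not depend on [x_i]; a deviation can only be profitable when [u_ii(x_i) < t]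
    and [x_i] does not maximize [u_ii].  A quasi-Leontief function is monotone,
    and its value at [u°(x) <= x] is [u(x)], so passing to the [u_ii°(x_i)] keeps
    each [u_ii] and can only lower each [t]. *)

(** The level set of [x] is the up-set of some [a] and contains [x]; from [a <= x <= y] it contains
    [y] too. *)
Lemma quasi_leontief_homo {d dL} {X : porderType d} {L : orderType dL}
    (u : X -> L) : quasi_leontief u -> {homo u : x y / x <= y}.
Proof.
move=> qu x y le_xy; have [a /seteqP[sub_a sup_a]] := qu x.
by apply: sup_a; apply: le_trans le_xy; apply: sub_a => /=.
Qed.

(** By [qu x] the [xget] choice is a true generator of the level set of [x], to which [x] itself
    belongs. *)
Lemma ucirc_le {d dL} {X : porderType d} {L : orderType dL} (u : X -> L) x :
  quasi_leontief u -> ucirc u x <= x.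
Proof.
move=> qu; have /seteqP[sub_a _] := xgetPex x (qu x).
by apply: sub_a => /=.
Qed.

Lemma quasi_leontief_ucirc {d dL} {X : porderType d} {L : orderType dL}
    (u : X -> L) x : quasi_leontief u -> u (ucirc u x) = u x.
Proof.
move=> qu; apply/le_anti/andP; split.
  exact/quasi_leontief_homo/ucirc_le.
(* Conversely, the generator lies in its own up-set, which is the level set of [x]. *)
have /seteqP[_ sup_a] := xgetPex x (qu x).
by apply: sup_a => /=.
Qed.

(** The starting value of the iterated minimum is itself a value of [F], so it adds no constraint on
    [l]. *)
Lemma le_finminP {dL} {L : orderType dL} {I : finType} (hI : (0 < #|I|)%N)
    (F : I -> L) (l : L) : l <= finmin hI F <-> forall i, l <= F i.
Proof.
split=> [/bigmin_geP[_ lF] i|lF]; first exact: lF.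
by apply/bigmin_geP; split.
Qed.

Lemma le_finmin {dL} {L : orderType dL} {I : finType} (hI : (0 < #|I|)%N)
    (F G : I -> L) : (forall i, F i <= G i) -> finmin hI F <= finmin hI G.
Proof.
by move=> FG; apply/le_finminP => i; apply: le_trans (FG i); move: i;
   apply/le_finminP.
Qed.

Section Game.
Context {n : nat} (hn : (1 < n)%N) {d : 'I_n -> Order.disp_t}.
Context {dL : Order.disp_t} {L : orderType dL}.
Context {X : forall i : 'I_n, meetSemilatticeType (d i)}.
Context (v : forall i j : 'I_n, X j -> L).
Arguments v : clear implicits.

Lemma min_utilityE i (x : profile X) :
  min_utility hn v i x =
  Order.min (v i i (x i)) (tilde_utility hn v i (drop_player x i)).
Proof.
apply/le_anti/andP; split.
  have /le_finminP le_u := lexx (min_utility hn v i x).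
  by rewrite le_min le_u; apply/le_finminP => j; exact: le_u.
apply/le_finminP => j; have [->|ne_ji] := eqVneq j i.
  by rewrite ge_min lexx.
rewrite ge_min; apply/orP; right.
have /le_finminP le_t := lexx (tilde_utility hn v i (drop_player x i)).
exact: (le_t (exist _ j ne_ji)).
Qed.

(** A deviation of player [i] leaves the rivals' coordinates alone, so the second argument of the
    minimum is that of [x]. *)
Lemma min_utility_dfwith i (x : profile X) (xi : X i) :
  min_utility hn v i (dfwith x xi) =
  Order.min (v i i xi) (tilde_utility hn v i (drop_player x i)).
Proof.
rewrite min_utilityE dfwith_in; congr (Order.min _ (tilde_utility _ _ _ _)).
apply: functional_extensionality_dep => -[j ne_ji].
by rewrite /drop_player dfwith_out // eq_sym.
Qed.

Lemma le_min_utility i (x y : profile X) :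
  (forall j, v i j (x j) <= v i j (y j)) ->
  min_utility hn v i x <= min_utility hn v i y.
Proof. exact: le_finmin. Qed.

Lemma nash_pointP (S : forall i, set (X i)) (u : 'I_n -> profile X -> L) x :
    (forall i x, u i x = min_utility hn v i x) -> (forall i, S i (x i)) ->
  nash_point u S x <->
  forall i, argmax (v i i) (S i) (x i) \/
            tilde_utility hn v i (drop_player x i) <= v i i (x i).
Proof.
move=> uE Sx; split=> [[_ nash_x] i|best_x].
  have [|lt_vt] := leP (tilde_utility hn v i (drop_player x i)) (v i i (x i)).
    by right.
  (* Here the payoff at [x] is [v i i (x i)], strictly below the rivals' minimum. A deviation's
     payoff can stay below it only if [v i i y] does. *)
  left; split=> // y /nash_x; rewrite !uE min_utility_dfwith min_utilityE.
  by rewrite (min_l (ltW lt_vt)) ge_min (lt_geF lt_vt) orbF.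
split=> // i y Sy; rewrite !uE min_utility_dfwith min_utilityE.
(* A maximizer makes the first argument of the minimum as large as possible; otherwise the payoff
   already equals the rivals' minimum, which caps every deviation. *)
have [[_ max_x]|le_tv] := best_x i.
  by rewrite le_min !ge_min lexx orbT max_x.
by rewrite (min_r le_tv) ge_min lexx orbT.
Qed.

End Game.

Theorem proposition2p1p1 (n : nat) (hn : (1 < n)%N)
    (dL : Order.disp_t) (L : orderType dL)
    (d : 'I_n -> Order.disp_t) (X : forall i : 'I_n, meetSemilatticeType (d i))
    (S : forall i : 'I_n, set (X i))
    (S_nonempty : forall i, S i !=set0)
    (S_comprehensive : forall i, comprehensive (S i))
    (S_bounded : forall i, has_ubound (S i))
    (v : forall i j : 'I_n, X j -> L)
    (v_quasi_leontief : forall i j, quasi_leontief (v i j))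
    (u : 'I_n -> profile X -> L)
    (uE : forall i (x : profile X), u i x = min_utility hn v i x) :
  (forall x : profile X, (forall i, S i (x i)) ->
     (nash_point u S x <->
      forall i, argmax (v i i) (S i) (x i) \/
                tilde_utility hn v i (drop_player x i) <= v i i (x i))) /\
  (forall x : profile X, nash_point u S x ->
     nash_point u S (fun i => ucirc (v i i) (x i)) /\
     forall i, u i (fun j => ucirc (v j j) (x j)) <= u i x).
Proof.
split=> [x Sx|x nash_x]; first exact: nash_pointP.
have Sx := nash_x.1.
have le_ucirc i j : v i j (ucirc (v j j) (x j)) <= v i j (x j).
  exact/quasi_leontief_homo/ucirc_le.
split=> [|i]; last by rewrite !uE; exact: le_min_utility.
have Sa i : S i (ucirc (v i i) (x i)).
  by apply: S_comprehensive (Sx i) _; exact: ucirc_le.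
(* Own values are unchanged, so maximizers stay maximizers, and in the other case the threshold to
   be met has only dropped. *)
apply/(nash_pointP uE Sa) => i; rewrite /argmax /= quasi_leontief_ucirc //.
have [[_ max_x]|le_tv] := (nash_pointP uE Sx).1 nash_x i; first by left.
by right; apply: le_trans le_tv; apply: le_finmin => j; exact: le_ucirc.
Qed.
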